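(* The generating function $\mathcal A=\sum_{n\ge0}\mathcal A_n^{FC}(q)x^n$ of fully commutative involutions of type $A$ satisfies $$\mathcal A=\frac{\sum_{j\ge0}x^j\,{j\brack \lfloor j/2\rfloor}_{q^2}\,q^{-\lfloor j/2\rfloor^2+\chi(j\ \mathrm{odd})}}{1+\sum_{j\ge1}(-x)^j\,{j-1\brack \lfloor j/2\rfloor}_{q^2}\,q^{-\lfloor j/2\rfloor^2}},$$ where $\chi(j\ \mathrm{odd})$ is $1$ if $j$ is odd and $0$ otherwise, and ${k\brack i}_{q^2}=\frac{(q^2;q^2)_k}{(q^2;q^2)_i(q^2;q^2)_{k-i}}$.
   Context: $A_n$ is the Coxeter group of type $A_n$ (symmetric group on $n+1$ letters with the $n$ adjacent transpositions), $A_0$ trivial. $w$ is fully commutative if any reduced expression can be obtained from any other using only commutation relations $st=ts$ ($m_{st}=2$); a fully commutative involution is such $w$ with $w^2=1$ (identity included). $\mathcal A_n^{FC}(q)=\sum q^{\ell(w)}$ over fully commutative involutions $w$ of $A_n$. $(a;q^2)_n=(1-a)(1-aq^2)\cdots(1-aq^{2n-2})$. *)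

(* Defs.v *)
From HB Require Import structures.
From mathcomp Require Import all_boot all_order all_fingroup all_algebra.

Set Implicit Arguments.
Unset Strict Implicit.
Unset Printing Implicit Defensive.

Import GRing.Theory.

Section TypeA.
Variable n : nat.
Local Open Scope group_scope.

Definition adj_transp (i : 'I_n) : 'S_n.+1 :=
  tperm (widen_ord (leqnSn n) i) (lift ord0 i).

Definition coxeter_m (i j : 'I_n) : nat := #[adj_transp i * adj_transp j].

Definition word_prod (a : seq 'I_n) : 'S_n.+1 := \prod_(i <- a) adj_transp i.

Definition has_word_of_size (w : 'S_n.+1) (k : nat) : bool :=
  [exists a : k.-tuple 'I_n, word_prod a == w].

Lemma adj_transp_gen : <<[set adj_transp i | i : 'I_n]>> = [set: 'S_n.+1].
Proof.
apply/eqP; rewrite eqEsubset subsetT -(gen_tperm ord0) gen_subG.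
apply/subsetP=> _ /imsetP[[k ltk] _ ->].
elim: k ltk => [|k IHk] ltk.
  by rewrite (_ : Ordinal ltk = ord0) ?tperm1 ?group1 //; apply: val_inj.
have ltkn : k < n by [].
have sk : adj_transp (Ordinal ltkn) \in <<[set adj_transp i | i : 'I_n]>>.
  by apply/mem_gen/imsetP; exists (Ordinal ltkn).
have skE : adj_transp (Ordinal ltkn) = tperm (Ordinal (ltnW ltk)) (Ordinal ltk).
  by congr tperm; apply: val_inj.
have [k0|k_gt0] := posnP k.
  rewrite skE in sk.
  by rewrite (_ : ord0 = Ordinal (ltnW ltk)) //; apply: val_inj; rewrite /= k0.
rewrite (_ : tperm _ _ = tperm ord0 (Ordinal (ltnW ltk)) ^ adj_transp (Ordinal ltkn)).
  by rewrite groupJ // IHk.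
by rewrite tpermJ skE tpermL tpermD // -val_eqE /= -lt0n.
Qed.

Lemma has_word (w : 'S_n.+1) : exists k, has_word_of_size w k.
Proof.
have: w \in <<[set adj_transp i | i : 'I_n]>> by rewrite adj_transp_gen inE.
case/gen_prodgP=> k [c Ac ->]; exists k.
have /fin_all_exists[f fE] i : exists j, c i = adj_transp j.
  by have /imsetP[j _ ->] := Ac i; exists j.
apply/existsP; exists [tuple f i | i < k]; apply/eqP.
by rewrite /word_prod /= big_map enumT; apply: eq_bigr => i _; rewrite fE.
Qed.

Definition coxeter_length (w : 'S_n.+1) : nat := ex_minn (has_word w).

Definition reduced_expr (w : 'S_n.+1) (a : (coxeter_length w).-tuple 'I_n) : bool :=
  word_prod a == w.

(* One application of a relation st = ts with m_st = 2: the adjacent letters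
   in positions i and i + 1 of the word a are exchanged. *)
Definition commutation_move (k : nat) : rel (k.-tuple 'I_n) := fun a b =>
  [exists i : 'I_k, exists j : 'I_k,
    [&& j == i.+1 :> nat, coxeter_m (tnth a i) (tnth a j) == 2
      & b == [tuple tnth a (tperm i j l) | l < k]]].

Definition fully_commutative (w : 'S_n.+1) : bool :=
  [forall a : (coxeter_length w).-tuple 'I_n,
   forall b : (coxeter_length w).-tuple 'I_n,
    reduced_expr a ==> reduced_expr b ==> connect (@commutation_move _) a b].

Definition fc_involution (w : 'S_n.+1) : bool :=
  fully_commutative w && (w ^+ 2 == 1).

End TypeA.

Local Open Scope ring_scope.

Definition fc_inv_poly (n : nat) : {poly int} :=
  \sum_(w : 'S_n.+1 | fc_involution w) 'X^(coxeter_length w).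

Section QAnalogues.
Variable K : fieldType.

Definition q_pochhammer (a p : K) (n : nat) : K := \prod_(i < n) (1 - a * p ^+ i).

(* Only meaningful for i <= k and p not a root of unity. *)
Definition q_binomial (p : K) (k i : nat) : K :=
  q_pochhammer p p k / (q_pochhammer p p i * q_pochhammer p p (k - i)).

End QAnalogues.

(* A formal power series is given by its sequence of coefficients. *)
Section PowerSeries.
Variable K : fieldType.
Implicit Types f g d : nat -> K.

Definition fps_mul f g : nat -> K := fun n => \sum_(i < n.+1) f i * g (n - i)%N.

(* The first n coefficients of f / d, for d 0 != 0. *)
Fixpoint fps_div_seq f d (n : nat) : seq K :=
  if n is m.+1 then
    let s := fps_div_seq f d m in
    rcons s ((f m - \sum_(i < m) s`_i * d (m - i)%N) / d 0%N)
  else [::].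

Definition fps_div f d : nat -> K := fun n => (fps_div_seq f d n.+1)`_n.

Lemma size_fps_div_seq f d n : size (fps_div_seq f d n) = n.
Proof. by elim: n => //= n IHn; rewrite size_rcons IHn. Qed.

Lemma nth_fps_div_seq f d n i : (i < n)%N ->
  (fps_div_seq f d n)`_i = fps_div f d i.
Proof.
elim: n => // n IHn; rewrite ltnS leq_eqVlt => /predU1P[-> //|lt_in] /=.
by rewrite nth_rcons size_fps_div_seq lt_in IHn.
Qed.

Lemma fps_divE f d n :
  fps_div f d n = (f n - \sum_(i < n) fps_div f d i * d (n - i)%N) / d 0%N.
Proof.
rewrite {1}/fps_div /= nth_rcons size_fps_div_seq ltnn eqxx.
by under eq_bigr => i _ do rewrite nth_fps_div_seq //.
Qed.

Lemma fps_divK f d : d 0%N != 0 -> fps_mul (fps_div f d) d =1 f.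
Proof.
move=> d0 n; rewrite /fps_mul big_ord_recr /= subnn [in X in _ + X]fps_divE.
by rewrite divfK // addrC subrK.
Qed.

Lemma fps_mulK f d : d 0%N != 0 -> fps_div (fps_mul f d) d =1 f.
Proof.
move=> d0 n; elim/ltn_ind: n => n IHn; rewrite fps_divE.
under eq_bigr => i _ do rewrite IHn //.
by rewrite /fps_mul big_ord_recr /= subnn addrC addrK mulfK.
Qed.

End PowerSeries.

(* The ground field is Q(q), the fraction field of Z[q]; it contains the
   Laurent polynomials in q, and q is not a root of unity in it. *)
Definition qvar : {fraction {poly int}} := tofrac 'X.

(* Main.v *)
Require Import Defs.
From mathcomp Require Import all_boot all_fingroup all_algebra.
From mathcomp Require Import cyclic zify ring.

(** A permutation is fully commutative iff it avoids 321: commutation moves preserve the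
letter counts of a word and a 321 pattern produces a braid; conversely two left descents
of a 321-avoiding permutation are never adjacent, so they commute.  Both this and the
rest rely on the fact that if [x < y] is an inversion of a 321-avoiding [w], then
[x < w x] and [w y < y].  It implies that the length of [w] is the sum over [k] of the
numbers [#{x < k <= w x}], and that, when [w] is an involution, recording for each [x]
whether [w x] is above, below or equal to [x] gives a path from height 0 to height 0 that
stays nonnegative and has flat steps at height 0 only.  This is a bijection, under which
the length becomes the sum of the heights.

Let [F_h] be the generating function of such paths started at height [h], and [B_h] that
of all paths with steps +1 and -1 from [h] to 0, possibly going below 0.  Both satisfy
the same recursion for [h > 0], so [F_h D = B_h] for a series [D] that is read off at
[h = 0], and [A D = q B_1 + B_0].  The coefficients of [B_h] are powers of [q] times
q-binomials, by the q-Pascal rule. *)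

Set Implicit Arguments.
Unset Strict Implicit.
Unset Printing Implicit Defensive.
Import GRing.Theory.

(** * Permutations avoiding the pattern 321 *)

Section Avoidance.
Variable N : nat.
Implicit Types (w : 'S_N) (x y z : 'I_N).
Local Open Scope group_scope.

Lemma card_ord_lt m : m <= N -> #|[set x : 'I_N | x < m]| = m.
Proof.
move=> le_m; rewrite cardsE -sum1_card (eq_bigl (fun x : 'I_N => x < m)) //.
by rewrite (big_ord_narrow le_m) sum_nat_const card_ord muln1.
Qed.

Lemma perm_neq w x y : x < y -> w x != w y :> nat.
Proof. by move=> lt_xy; rewrite val_eqE (inj_eq perm_inj) -val_eqE neq_ltn lt_xy. Qed.

Lemma perm_increasing1 w : {homo w : x y / x < y} -> w = 1.
Proof.
move=> incr; apply/permP=> x; apply: ord_inj; rewrite perm1.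
rewrite -[LHS](card_ord_lt (ltnW (ltn_ord _))) -[RHS](card_ord_lt (ltnW (ltn_ord _))).
rewrite -(card_preimset _ (@perm_inj _ w)); apply: eq_card => y; rewrite !inE.
by case: (ltngtP y x) => [/incr//|/incr|/ord_inj->]; [lia | rewrite ltnn].
Qed.

Definition pattern321 w x y z : bool := [&& x < y, y < z, w z < w y & w y < w x].

Definition avoids321 w : bool := [forall x, forall y, forall z, ~~ pattern321 w x y z].

Lemma avoids321P w : reflect (forall x y z, ~~ pattern321 w x y z) (avoids321 w).
Proof.
apply: (iffP forallP) => [av x y z|av x].
  by have /forallP/(_ y)/forallP/(_ z) := av x.
by apply/forallP=> y; apply/forallP=> z.
Qed.

Lemma avoids321Pn w : reflect (exists x y z, pattern321 w x y z) (~~ avoids321 w).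
Proof.
apply: (iffP idP) => [|[x [y [z pat]]]]; last by apply/avoids321P=> /(_ x y z)/negP.
by case/forallPn=> x /forallPn[y /forallPn[z /negPn pat]]; exists x, y, z.
Qed.

Lemma avoids321V w : avoids321 w -> avoids321 w^-1.
Proof.
move=> /avoids321P av; apply/avoids321P=> x y z.
have := av (w^-1 z) (w^-1 y) (w^-1 x); rewrite /pattern321 !permKV.
by apply: contra => /and4P[-> -> -> ->].
Qed.

(* The position [y] and those up to [x] all have values at most [w x]. *)
Lemma avoids321_inversion_left w x y : avoids321 w -> x < y -> w y < w x -> x < w x.
Proof.
move=> /avoids321P av lt_xy lt_w.
have sub : w @: (y |: [set z : 'I_N | z < x.+1]) \subset [set v : 'I_N | v < (w x).+1].
  apply/subsetP=> _ /imsetP[z + ->]; rewrite !inE => /predU1P[->|]; first exact: ltnW.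
  rewrite !ltnS leq_eqVlt => /predU1P[/ord_inj-> //|lt_zx].
  by have := av z x y; rewrite /pattern321 lt_zx lt_xy lt_w /= -leqNgt.
have := subset_leq_card sub; rewrite card_imset; last exact: perm_inj.
by rewrite cardsU1 inE !card_ord_lt //; lia.
Qed.

Lemma avoids321_inversion w x y :
  avoids321 w -> x < y -> w y < w x -> x < w x /\ w y < y.
Proof.
move=> av lt_xy lt_w; split; first exact: avoids321_inversion_left av lt_xy lt_w.
have := @avoids321_inversion_left _ (w y) (w x) (avoids321V av) lt_w.
by rewrite !permK; apply.
Qed.

Lemma avoids321_of_inversion w :
  (forall x y, x < y -> w y < w x -> x < w x /\ w y < y) -> avoids321 w.
Proof.
move=> inv; apply/avoids321P=> x y z; apply/negP=> /and4P[lt_xy lt_yz lt_wzy lt_wyx].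
by have [_] := inv _ _ lt_xy lt_wyx; have [] := inv _ _ lt_yz lt_wzy; lia.
Qed.

End Avoidance.

(** * Length and inversions *)

Section Length.
Variable n : nat.
Implicit Types (w : 'S_n.+1) (i j : 'I_n) (x y z : 'I_n.+1) (a b : seq 'I_n).
Local Open Scope group_scope.
Local Notation s := (@adj_transp n).

Definition left_pos (i : 'I_n) : 'I_n.+1 := widen_ord (leqnSn n) i.
Definition right_pos (i : 'I_n) : 'I_n.+1 := lift ord0 i.

Lemma val_right_pos i : right_pos i = i.+1 :> nat.
Proof. by []. Qed.

Lemma left_lt_right i : left_pos i < right_pos i.
Proof. exact: leqnn. Qed.

Lemma ord_left_pos i x : x = i :> nat -> x = left_pos i.
Proof. by move=> ex; apply: ord_inj. Qed.

Lemma ord_right_pos i x : x = i.+1 :> nat -> x = right_pos i.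
Proof. by move=> ex; apply: ord_inj. Qed.

Lemma left_pos_next i j : j = i.+1 :> nat -> left_pos j = right_pos i.
Proof. by move=> next_ij; apply: ord_right_pos. Qed.

Lemma adj_left i : s i (left_pos i) = right_pos i.
Proof. exact: tpermL. Qed.

Lemma adj_right i : s i (right_pos i) = left_pos i.
Proof. exact: tpermR. Qed.

Lemma adj_fix i x : x != i :> nat -> x != i.+1 :> nat -> s i x = x.
Proof. by move=> ne_l ne_r; apply: tpermD; rewrite eq_sym -val_eqE. Qed.

Lemma val_adj_cases i x :
  x = i :> nat /\ s i x = i.+1 :> nat \/ x = i.+1 :> nat /\ s i x = i :> nat
    \/ x <> i :> nat /\ x <> i.+1 :> nat /\ s i x = x :> nat.
Proof.
have [/ord_left_pos->|ne_l] := eqVneq (x : nat) i; first by left; rewrite adj_left.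
have [/ord_right_pos->|ne_r] := eqVneq (x : nat) i.+1; first by right; left; rewrite adj_right.
by right; right; rewrite adj_fix //; split; [apply/eqP | split=> //; apply/eqP].
Qed.

Lemma adj_mono i x y : x < y -> (x, y) != (left_pos i, right_pos i) -> s i x < s i y.
Proof.
rewrite xpair_eqE -!val_eqE /= /bump /= add1n.
by have := val_adj_cases i x; have := val_adj_cases i y; lia.
Qed.

Lemma adjK i : involutive (s i).
Proof. exact: tpermK. Qed.

Lemma adj_mulK i : involutive (mulg (s i)).
Proof. by move=> w; rewrite mulgA tperm2 mul1g. Qed.

Definition far i j : bool := (i.+1 < j) || (j.+1 < i).

Lemma adj_fix_far i j :
  far i j -> s j (left_pos i) = left_pos i /\ s j (right_pos i) = right_pos i.
Proof. by rewrite /far => far_ij; split; apply: adj_fix; rewrite ?val_right_pos /=; lia. Qed.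

Lemma farC i j : far i j = far j i.
Proof. exact: orbC. Qed.

Lemma adj_conj i w : s i ^ w = tperm (w (left_pos i)) (w (right_pos i)).
Proof. exact: tpermJ. Qed.

Lemma adj_commute i j : far i j -> commute (s i) (s j).
Proof.
by case/adj_fix_far=> fix_l fix_r; apply/commgP/conjg_fixP; rewrite adj_conj fix_l fix_r.
Qed.

Lemma adj_braid i j : j = i.+1 :> nat -> s i * (s j * s i) = s j * (s i * s j).
Proof.
move=> next_ij; have conjE k l : s k * (s l * s k) = s l ^ s k by rewrite conjgE tpermV.
rewrite !conjE !adj_conj (left_pos_next next_ij) adj_right -(left_pos_next next_ij) adj_left.
by rewrite !adj_fix ?val_right_pos //= next_ij; lia.
Qed.

Lemma coxeter_m_far i j : far i j -> coxeter_m i j = 2.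
Proof.
move=> far_ij; apply: nt_prime_order => //.
  rewrite expgMn; last exact: adj_commute.
  by rewrite !expgS !mulg1 !tperm2 mulg1.
have [_ fix_r] := adj_fix_far far_ij.
apply/eqP=> /permP/(_ (left_pos i)); rewrite permM perm1 adj_left fix_r => eq_rl.
by have := left_lt_right i; rewrite eq_rl ltnn.
Qed.

Definition inversions w : {set 'I_n.+1 * 'I_n.+1} :=
  [set p : 'I_n.+1 * 'I_n.+1 | (p.1 < p.2) && (w p.2 < w p.1)].

Definition num_inversions w : nat := #|inversions w|.

Definition descent w i : bool := w (right_pos i) < w (left_pos i).

Lemma descent_adj w i : descent (s i * w) i = ~~ descent w i.
Proof.
by rewrite /descent !permM adj_left adj_right; have := perm_neq w (left_lt_right i); lia.
Qed.

Lemma descent_adj_far w i j :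
  far i j -> descent (s i * w) j = descent w j.
Proof.
by rewrite farC => /adj_fix_far[fix_l fix_r]; rewrite /descent !permM fix_l fix_r.
Qed.

Definition adj_pair i (p : 'I_n.+1 * 'I_n.+1) := (s i p.1, s i p.2).

Lemma adj_pairK i : involutive (adj_pair i).
Proof. by case=> x y; rewrite /adj_pair /= !adjK. Qed.

Lemma inversions_ascent w i : ~~ descent w i ->
  inversions (s i * w) = (left_pos i, right_pos i) |: adj_pair i @: inversions w.
Proof.
move=> asc; have pairK := @adj_pairK i; apply/setP=> -[x y].
rewrite !inE -[(x, y) in RHS]pairK (mem_imset _ _ (inv_inj pairK)) pairK.
rewrite !inE /= !permM; have [[-> ->]|ne] := eqVneq (x, y) _.
  by move: asc; rewrite -descent_adj /descent !permM val_right_pos /= => ->; rewrite leqnn.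
rewrite /=; have [lt_w|] := boolP (w (s i y) < w (s i x)); rewrite ?andbF // !andbT.
apply/idP/idP=> lt; first exact: adj_mono.
rewrite -[x](adjK i) -[y](adjK i); apply: adj_mono => //.
by apply: contraNneq asc => -[ex ey]; rewrite /descent -ex -ey.
Qed.

Lemma num_inversions_ascent w i :
  ~~ descent w i -> num_inversions (s i * w) = (num_inversions w).+1.
Proof.
move=> asc; have pairK := @adj_pairK i.
rewrite /num_inversions inversions_ascent // cardsU1 card_imset; last exact: inv_inj.
rewrite (_ : _ \notin _) // -[(left_pos i, _)]pairK (mem_imset _ _ (inv_inj pairK)).
by rewrite /adj_pair /= adj_left adj_right inE /= ltnNge leqnSn.
Qed.

Lemma num_inversions_descent w i :
  descent w i -> num_inversions w = (num_inversions (s i * w)).+1.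
Proof.
by move=> desc; rewrite -(@num_inversions_ascent _ i) ?adj_mulK // descent_adj negbK.
Qed.

Lemma num_inversions1 : num_inversions 1 = 0.
Proof. by apply: eq_card0 => -[x y]; rewrite !inE !perm1 /=; lia. Qed.

Lemma descent_between w x y :
  x < y -> w y < w x -> exists2 i : 'I_n, x <= i < y & descent w i.
Proof.
move=> lt_xy lt_w.
have [/existsP[i /andP[]]|/existsPn no_desc] :=
  boolP [exists i : 'I_n, (x <= i < y) && descent w i]; first by exists i.
suff increasing m z : z = (x + m)%N :> nat -> z <= y -> w x <= w z.
  by have := increasing (y - x)%N y; lia.
elim: m z => [|m IHm] z ez le_zy; first by rewrite (_ : x = z) //; apply: ord_inj; lia.
have lt_m : x + m < n by have := ltn_ord z; lia.
have := no_desc (Ordinal lt_m); rewrite /descent -(@ord_right_pos (Ordinal lt_m) z) /=; last lia.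
by have := IHm (left_pos (Ordinal lt_m)) erefl => /=; lia.
Qed.

Lemma perm_no_descent1 w : (forall i, ~~ descent w i) -> w = 1.
Proof.
move=> no_desc; apply: perm_increasing1 => x y lt_xy.
have [//|gt_w|/eqP] := ltngtP (w x) (w y); last by rewrite (negbTE (perm_neq w lt_xy)).
by have [i _] := descent_between lt_xy gt_w; rewrite (negbTE (no_desc i)).
Qed.

Lemma word_prod_cons i a : word_prod (i :: a) = s i * word_prod a.
Proof. exact: big_cons. Qed.

Lemma num_inversions_word a : num_inversions (word_prod a) <= size a.
Proof.
elim: a => [|i a IHa]; first by rewrite /word_prod big_nil num_inversions1.
rewrite word_prod_cons /=; have [desc|asc] := boolP (descent (word_prod a) i).
  by move: (num_inversions_descent desc); lia.
by rewrite num_inversions_ascent.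
Qed.

Definition reduced w a : bool := (word_prod a == w) && (size a == num_inversions w).

Lemma reduced_nil w : reduced w [::] = (w == 1).
Proof.
rewrite /reduced /word_prod big_nil eq_sym; case: eqP => // ->.
by rewrite num_inversions1.
Qed.

Lemma reduced_cons w i a : reduced w (i :: a) = descent w i && reduced (s i * w) a.
Proof.
rewrite /reduced word_prod_cons /= (can2_eq (adj_mulK i) (adj_mulK i)).
case: eqP => [wa|_]; last by rewrite andbF.
have [desc|asc] := boolP (descent w i); first by rewrite (num_inversions_descent desc) eqSS.
have := num_inversions_word a; rewrite wa num_inversions_ascent //= => le_a.
by apply/negbTE/eqP; lia.
Qed.

Lemma reduced_exists w : exists a, reduced w a.
Proof.
have [k] := ubnP (num_inversions w); elim: k w => // k IHk w.
have [/existsP[i desc]|/existsPn/perm_no_descent1->] := boolP [exists i, descent w i].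
  rewrite (num_inversions_descent desc) ltnS => /IHk[a red_a].
  by exists (i :: a); rewrite reduced_cons desc.
by exists [::]; rewrite reduced_nil.
Qed.

Lemma coxeter_lengthE w : coxeter_length w = num_inversions w.
Proof.
have [a /andP[/eqP wa /eqP sz_a]] := reduced_exists w.
rewrite /coxeter_length; case: ex_minnP => m /existsP[b /eqP wb] min_m.
have := num_inversions_word b; rewrite wb size_tuple => le_m.
apply/eqP; rewrite eqn_leq le_m andbT; apply: min_m.
by apply/existsP; exists (Tuple (introT eqP sz_a)); rewrite /= wa.
Qed.

Lemma reduced_exprE w (a : (coxeter_length w).-tuple 'I_n) : reduced_expr a = reduced w a.
Proof. by rewrite /reduced size_tuple -coxeter_lengthE eqxx andbT. Qed.

End Length.

(** * Full commutativity *)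

Lemma connect_min (T : finType) (e r : rel T) :
  reflexive r -> transitive r -> subrel e r -> subrel (connect e) r.
Proof.
move=> r_refl r_trans er x y /connectP[p + ->].
elim: p x => //= z p IHp x /andP[/er xz /IHp]; exact: r_trans.
Qed.

Lemma nth_swap (T : Type) (x0 x y : T) u v l :
  nth x0 (u ++ y :: x :: v) l =
  nth x0 (u ++ x :: y :: v)
    (if l == size u then (size u).+1 else if l == (size u).+1 then size u else l).
Proof.
rewrite !nth_cat; case: eqP => [->|ne_l]; first by rewrite ltnn subnn ltnNge leqnSn subSnn.
case: eqP => [->|ne_l1]; first by rewrite ltnn subnn ltnNge leqnSn subSnn.
by case: ltnP => // le_l; case diff: (l - size u)%N => [|[|m]] //=; lia.
Qed.

Lemma eq_tuple_swap (T : eqType) k (a b : k.-tuple T) u v x y (i j : 'I_k) :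
  tval a = u ++ x :: y :: v -> i = size u :> nat -> j = i.+1 :> nat ->
  (b == [tuple tnth a (tperm i j l) | l < k]) = (tval b == u ++ y :: x :: v).
Proof.
move=> ea ei ej; rewrite -val_eqE; congr (_ == _).
apply: (@eq_from_nth _ x); first by rewrite size_tuple -(size_tuple a) ea !size_cat.
move=> l; rewrite size_tuple => lt_l.
rewrite nth_swap -ea -(tnth_nth x _ (Ordinal lt_l)) tnth_mktuple (tnth_nth x).
congr nth; rewrite permE /= -!val_eqE /= ej ei.
by case: eqP => _ /=; [rewrite ej ei | case: eqP => _ //=; rewrite ei].
Qed.

Section Commutation.
Variable n : nat.
Implicit Types (w : 'S_n.+1) (i j : 'I_n) (x y z : 'I_n.+1) (a b : seq 'I_n).
Local Open Scope group_scope.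
Local Notation s := (@adj_transp n).

Variant commute_swap a b : Prop :=
  CommuteSwap u v i j of a = u ++ i :: j :: v & b = u ++ j :: i :: v & coxeter_m i j = 2.

Lemma commutation_moveP k (a b : k.-tuple 'I_n) :
  reflect (commute_swap a b) (commutation_move a b).
Proof.
apply: (iffP idP) => [/existsP[i /existsP[j /and3P[/eqP ej /eqP mij eb]]]|[u v x y ea eb mxy]].
  have ea : tval a = take i a ++ tnth a i :: tnth a j :: drop j.+1 a.
    have x0 := tnth a i.
    rewrite !(tnth_nth x0) -{1}[tval a](cat_take_drop i); congr (_ ++ _).
    by rewrite (drop_nth x0) ?size_tuple // -ej (drop_nth x0) ?size_tuple.
  have size_i : i = size (take i a) :> nat by rewrite size_take size_tuple ltn_ord.
  exists (take i a) (drop j.+1 a) (tnth a i) (tnth a j) => //.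
  by apply/eqP; rewrite -(eq_tuple_swap _ ea size_i ej).
have size_a := size_tuple a; rewrite ea size_cat /= in size_a.
have lt_i : size u < k by lia.
have lt_j : (size u).+1 < k by lia.
apply/existsP; exists (Ordinal lt_i); apply/existsP; exists (Ordinal lt_j).
rewrite (eq_tuple_swap _ ea) // eb !eqxx /= !(tnth_nth x) /= ea !nth_cat.
by rewrite ltnn subnn ltnNge leqnSn subSnn /= mxy.
Qed.

Lemma connect_move_cons k i (a b : k.-tuple 'I_n) :
  connect (@commutation_move n k) a b ->
  connect (@commutation_move n k.+1) [tuple of i :: a] [tuple of i :: b].
Proof.
apply: (@connect_min _ _ (fun a b : k.-tuple 'I_n =>
  connect (@commutation_move n k.+1) [tuple of i :: a] [tuple of i :: b])).
- by move=> c; apply: connect0.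
- by move=> c1 c2 c3; apply: connect_trans.
move=> c d /commutation_moveP[u v x y ec ed mxy]; apply/connect1/commutation_moveP.
by exists (i :: u) v x y; rewrite //= ?ec ?ed.
Qed.

Lemma connect_move_perm_eq k (a b : k.-tuple 'I_n) :
  connect (@commutation_move n k) a b -> perm_eq a b.
Proof.
apply: (@connect_min _ _ (fun a b : k.-tuple 'I_n => perm_eq a b)) => [c||c d].
- exact: perm_refl.
- by move=> c1 c2 c3; apply: perm_trans.
case/commutation_moveP=> u v x y -> -> _; rewrite perm_cat2l.
exact/permPl/(perm_catCA [:: x] [:: y]).
Qed.

Lemma pattern321_adj w i x y z :
    pattern321 w x y z ->
    (x, y) != (left_pos i, right_pos i) -> (y, z) != (left_pos i, right_pos i) ->
  pattern321 (s i * w) (s i x) (s i y) (s i z).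
Proof.
by case/and4P=> xy yz wzy wyx nxy nyz; rewrite /pattern321 !permM !adjK wzy wyx !adj_mono.
Qed.

Lemma avoids321_adj w i : avoids321 w -> descent w i -> avoids321 (s i * w).
Proof.
move=> /avoids321P av desc; apply/avoids321P=> x y z; apply/negP=> pat.
have ascent_adj u v :
    (s i * w)%g v < (s i * w)%g u -> (u, v) != (left_pos i, right_pos i).
  by apply: contraTneq => -[-> ->]; rewrite !permM adj_left adj_right -leqNgt ltnW.
have /and4P[_ _ /ascent_adj nyz /ascent_adj nxy] := pat.
by have := pattern321_adj pat nxy nyz; rewrite adj_mulK; apply/negP.
Qed.

Lemma avoids321_descent w i :
  avoids321 w -> descent w i -> i < w (left_pos i) /\ w (right_pos i) <= i.
Proof. by move=> av; apply: avoids321_inversion av (left_lt_right i). Qed.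

Lemma avoids321_descents_far w i j :
  avoids321 w -> descent w i -> descent w j -> i != j -> far i j.
Proof.
move=> av desc_i desc_j; rewrite -val_eqE /far /=.
have not_next (k l : 'I_n) : descent w k -> descent w l -> l <> k.+1 :> nat.
  move=> desc_k desc_l next_kl.
  have [_ le_k] := avoids321_descent av desc_k; have [lt_l _] := avoids321_descent av desc_l.
  by move: lt_l; rewrite (left_pos_next next_kl); lia.
by have := not_next i j desc_i desc_j; have := not_next j i desc_j desc_i; lia.
Qed.

Lemma reduced_diamond w i j :
    far i j -> descent w i -> descent w j ->
  exists c, reduced (s i * w) (j :: c) /\ reduced (s j * w) (i :: c).
Proof.
move=> far_ij desc_i desc_j; have [c red_c] := reduced_exists (s j * (s i * w)); exists c.
rewrite !reduced_cons !descent_adj_far ?desc_i ?desc_j //; last by rewrite farC.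
by rewrite [s i * (s j * w)]mulgA adj_commute // -mulgA.
Qed.

Lemma avoids321_connect w k (a b : k.-tuple 'I_n) :
  avoids321 w -> reduced w a -> reduced w b -> connect (@commutation_move n k) a b.
Proof.
elim: k w a b => [|k IHk] w a b av; first by rewrite (tuple0 a) (tuple0 b).
case/tupleP: a => i a; case/tupleP: b => j b.
rewrite !reduced_cons => /andP[desc_i red_a] /andP[desc_j red_b].
have av_i := avoids321_adj av desc_i; have av_j := avoids321_adj av desc_j.
have [eij|ne_ij] := eqVneq i j.
  by subst j; apply: connect_move_cons (IHk _ _ _ av_i red_a red_b).
have far_ij := avoids321_descents_far av desc_i desc_j ne_ij.
have [c [red_jc red_ic]] := reduced_diamond far_ij desc_i desc_j.
have size_jc : size (j :: c) == k.
  by case/andP: red_jc red_a => _ /eqP-> /andP[_]; rewrite size_tuple eq_sym.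
have size_ic : size (i :: c) == k by [].
apply: connect_trans (connect_move_cons i (IHk _ a (Tuple size_jc) av_i red_a red_jc)) _.
apply: connect_trans (connect_move_cons j (IHk _ (Tuple size_ic) b av_j red_ic red_b)).
by apply/connect1/commutation_moveP; exists [::] c i j => //; apply: coxeter_m_far.
Qed.

Definition has_inequivalent_words w : Prop :=
  exists a b, [/\ reduced w a, reduced w b & ~~ perm_eq a b].

Lemma has_inequivalent_words_adj w i :
  descent w i -> has_inequivalent_words (s i * w) -> has_inequivalent_words w.
Proof.
move=> desc [a [b [red_a red_b ne_ab]]]; exists (i :: a), (i :: b).
by rewrite !reduced_cons desc perm_cons.
Qed.

Lemma has_inequivalent_words_braid w i j :
  j = i.+1 :> nat -> descent w i -> descent w j -> has_inequivalent_words w.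
Proof.
move=> next_ij desc_i desc_j; have [c red_c] := reduced_exists (s i * (s j * (s i * w))).
have left_j := left_pos_next next_ij.
have fix_i : s i (right_pos j) = right_pos j by rewrite adj_fix // val_right_pos; lia.
have fix_j : s j (left_pos i) = left_pos i by rewrite adj_fix //=; lia.
have red_iji : reduced w [:: i, j, i & c].
  rewrite !reduced_cons red_c desc_i andbT /=; move: desc_i desc_j.
  rewrite /descent !permM left_j fix_i fix_j adj_left adj_right -left_j adj_left fix_i; lia.
exists [:: i, j, i & c], [:: j, i, j & c]; split=> //.
  move: red_iji; rewrite /reduced !word_prod_cons /= => /andP[/eqP<- ->].
  by rewrite andbT !mulgA -(mulgA (s i)) adj_braid // !mulgA.
have ne_ij : i != j by rewrite -val_eqE /= next_ij; lia.
by apply/negP=> /seq.permP/(_ (pred1 i)) /=; rewrite eqxx [j == i]eq_sym (negbTE ne_ij); lia.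
Qed.

(* Any pattern 321 uses both positions exchanged by any descent, so the descents between
   its positions force these to be consecutive. *)
Lemma not_avoids321_adjacent_descents w :
    ~~ avoids321 w -> (forall i, descent w i -> avoids321 (s i * w)) ->
  exists i j, [/\ j = i.+1 :> nat, descent w i & descent w j].
Proof.
case/avoids321Pn=> x [y [z pat]] av_adj; have /and4P[xy yz wzy wyx] := pat.
have uses i : descent w i ->
    (x, y) = (left_pos i, right_pos i) \/ (y, z) = (left_pos i, right_pos i).
  move=> /av_adj/avoids321P/(_ (s i x) (s i y) (s i z)).
  have [|ne_xy] := eqVneq (x, y) (left_pos i, right_pos i); first by left.
  have [|ne_yz] := eqVneq (y, z) (left_pos i, right_pos i); first by right.
  by rewrite pattern321_adj.
have [i i_xy desc_i] := descent_between xy wyx; have [j j_yz desc_j] := descent_between yz wzy.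
have y_right : y = right_pos i.
  by case: (uses i desc_i) => -[y_left _] //; move: i_xy; rewrite y_left ltnn andbF.
have y_left : y = left_pos j.
  by case: (uses j desc_j) => -[_ y_r] //; move: j_yz; rewrite y_r ltnn.
by exists i, j; split=> //; rewrite -val_right_pos -y_right y_left.
Qed.

Lemma not_avoids321_words w : ~~ avoids321 w -> has_inequivalent_words w.
Proof.
have [k] := ubnP (num_inversions w); elim: k w => // k IHk w lt_k pat.
have [/existsP[i /andP[desc pat_i]]|/existsPn no_pat] :=
  boolP [exists i, descent w i && ~~ avoids321 (s i * w)].
  apply: (has_inequivalent_words_adj desc (IHk _ _ pat_i)).
  by move: lt_k; rewrite (num_inversions_descent desc).
have [|i [j [next_ij desc_i desc_j]]] := not_avoids321_adjacent_descents pat.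
  by move=> i desc; have := no_pat i; rewrite desc negbK.
exact: has_inequivalent_words_braid next_ij desc_i desc_j.
Qed.

Lemma fully_commutativeE w : fully_commutative w = avoids321 w.
Proof.
apply/forallP/idP => [fc|av a].
  apply/contraT=> /not_avoids321_words[a [b [red_a red_b /negP[]]]].
  have size_a : size a == coxeter_length w by rewrite coxeter_lengthE; case/andP: red_a.
  have size_b : size b == coxeter_length w by rewrite coxeter_lengthE; case/andP: red_b.
  have /forallP/(_ (Tuple size_b)) := fc (Tuple size_a).
  by rewrite !reduced_exprE red_a red_b => /connect_move_perm_eq.
apply/forallP=> b; rewrite !reduced_exprE; apply/implyP=> red_a; apply/implyP.
exact: avoids321_connect av red_a.
Qed.

End Commutation.

(** * Length of the permutations avoiding 321 *)

Definition crossings (N : nat) (w : 'S_N) (k : nat) : nat := #|[set x : 'I_N | x < k <= w x]|.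

Lemma crossings_size (N : nat) (w : 'S_N) : crossings w N = 0.
Proof. by apply: eq_card0 => x; rewrite !inE; have := ltn_ord (w x); lia. Qed.

Section LengthCrossings.
Variable n : nat.
Implicit Types (w : 'S_n.+1) (i : 'I_n).
Local Open Scope group_scope.
Local Notation s := (@adj_transp n).

Lemma crossings_adj w i k : k != i.+1 -> crossings (s i * w) k = crossings w k.
Proof.
move=> ne; rewrite /crossings -[RHS](card_preimset _ (@perm_inj _ (s i))).
by apply: eq_card => x; rewrite !inE permM; have := val_adj_cases i x; lia.
Qed.

Lemma crossings_descent w i :
  avoids321 w -> descent w i -> crossings w i.+1 = (crossings (s i * w) i.+1).+1.
Proof.
move=> av desc; have [lt_l le_r] := avoids321_descent av desc.
have notin : left_pos i \notin [set x : 'I_n.+1 | x < i.+1 <= (s i * w)%g x].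
  by rewrite inE permM adj_left; lia.
rewrite /crossings -[RHS]add1n -[1%N]/(nat_of_bool true) -notin -cardsU1.
apply: eq_card => x; rewrite !inE permM; have [->|ne] := eqVneq x (left_pos i).
  by rewrite ltnSn lt_l.
have ne_x : x != i :> nat by apply: contraNN ne => /eqP/ord_left_pos->.
by have [lt_x|//] := ltnP x i.+1; rewrite adj_fix //; lia.
Qed.

(* At a descent of a permutation avoiding 321, only one of the cuts loses a crossing. *)
Lemma avoids321_length w : avoids321 w -> coxeter_length w = \sum_(i < n) crossings w i.+1.
Proof.
have [a red_a] := reduced_exists w; rewrite coxeter_lengthE.
elim: a w red_a => [|i a IHa] w.
  rewrite reduced_nil => /eqP-> _; rewrite num_inversions1 big1 // => i _.
  by apply: eq_card0 => x; rewrite !inE perm1; lia.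
rewrite reduced_cons => /andP[desc red_a] av.
rewrite (num_inversions_descent desc) (IHa _ red_a (avoids321_adj av desc)).
rewrite (bigD1 i) //= [RHS](bigD1 i) //= (crossings_descent av desc) addSn; congr (_ + _).+1.
by apply: eq_bigr => j ne_ji; rewrite crossings_adj.
Qed.

End LengthCrossings.

(** * Paths *)

Local Notation up := (Some true).
Local Notation down := (Some false).
Local Notation flat := None.
Local Notation opposite := (omap negb).
Local Notation step := (nth flat).

Definition legal_step (h : nat) (c : option bool) : bool :=
  match c with up => true | down => 0 < h | flat => h == 0 end.

Definition next_height (h : nat) (c : option bool) : nat :=
  match c with up => h.+1 | down => h.-1 | flat => h end.

Lemma next_heightE h c : legal_step h c -> next_height h c + (c == down) = h + (c == up).
Proof. by case: c => [[]|] /=; lia. Qed.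

Fixpoint is_path (h : nat) (p : seq (option bool)) : bool :=
  if p is c :: p' then legal_step h c && is_path (next_height h c) p' else h == 0.

Fixpoint area (h : nat) (p : seq (option bool)) : nat :=
  if p is c :: p' then next_height h c + area (next_height h c) p' else 0.

Definition rank (c : option bool) (p : seq (option bool)) (k : nat) : nat :=
  \sum_(i < k) (step p i == c).

Lemma rank0 c p : rank c p 0 = 0.
Proof. exact: big_ord0. Qed.

Lemma rankS c p k : rank c p k.+1 = rank c p k + (step p k == c).
Proof. exact: big_ord_recr. Qed.

Lemma rank_cons c d p k : rank c (d :: p) k.+1 = (d == c) + rank c p k.
Proof. exact: big_ord_recl. Qed.

Lemma rank_mono c p : {homo rank c p : j k / j <= k}.
Proof.
by apply: (homo_leq leqnn) => [j i k|k]; [apply: leq_trans | rewrite rankS leq_addr].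
Qed.

Lemma rank_lt p j k : j < k -> rank (step p j) p j < rank (step p j) p k.
Proof. by move=> /(rank_mono (step p j) p); rewrite rankS eqxx addn1. Qed.

Lemma rank_inj p j k : step p j = step p k -> rank (step p j) p j = rank (step p k) p k -> j = k.
Proof.
move=> pjk ejk; case: (ltngtP j k) => // lt; have := rank_lt p lt.
  by rewrite ejk pjk ltnn.
by rewrite -ejk -pjk ltnn.
Qed.

Lemma rank_onto c p k v : v < rank c p k -> exists j, [/\ j < k, step p j = c & rank c p j = v].
Proof.
elim: k => [|k IHk]; first by rewrite rank0.
rewrite rankS; case: eqP => [pk|_]; rewrite ?addn0; last first.
  by case/IHk=> j [lt_jk pj rj]; exists j; split=> //; apply: ltnW.
rewrite addn1 ltnS leq_eqVlt => /predU1P[->|/IHk[j [lt_jk pj rj]]]; first by exists k.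
by exists j; split=> //; apply: ltnW.
Qed.

Lemma rank_card N c p k :
  k <= N -> rank c p k = #|[set x : 'I_N | (x < k) && (step p x == c)]|.
Proof.
move=> le_k; rewrite /rank (big_ord_widen N (fun i => (step p i == c) : nat) le_k).
by rewrite -big_mkcondr /= sum1dep_card cardsE.
Qed.

Lemma is_pathP h p :
  reflect [/\ forall k, k < size p -> step p k = flat -> h + rank up p k = rank down p k,
              forall k, k <= size p -> rank down p k <= h + rank up p k
            & h + rank up p (size p) = rank down p (size p)]
          (is_path h p).
Proof.
elim: p h => [|c p IHp] h /=.
  apply: (iffP eqP) => [->|[_ _]]; last by rewrite !rank0 addn0.
  by split=> [//|[|k] //|]; rewrite !rank0.
apply: (iffP andP) => [[legal /IHp[at0 above0 end0]]|[at0 above0 end0]].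
  have next := next_heightE legal; split; last by rewrite !rank_cons; lia.
    case=> [_ /= ec|k lt_k /(at0 _ lt_k)]; last by rewrite !rank_cons; lia.
    by move: legal; rewrite ec !rank0 addn0 /= => /eqP.
  by case=> [|k lt_k]; rewrite ?rank0 // !rank_cons; have := above0 _ lt_k; lia.
have legal : legal_step h c.
  case: c at0 above0 {end0} => [[]|] at0 above0 //=.
    by have := above0 1 isT; rewrite !rank_cons !rank0 /=; lia.
  by have := at0 0 isT erefl; rewrite !rank0 addn0 => ->.
have next := next_heightE legal; split=> //; apply/IHp; split.
- by move=> k lt_k pk; have := at0 k.+1 lt_k pk; rewrite !rank_cons; lia.
- by move=> k le_k; have := above0 k.+1 le_k; rewrite !rank_cons; lia.
- by move: end0; rewrite !rank_cons; lia.
Qed.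

Lemma area_rank h p : is_path h p ->
  area h p = \sum_(k < size p) (h + rank up p k.+1 - rank down p k.+1).
Proof.
elim: p h => [|c p IHp] h /=; first by rewrite big_ord0.
case/andP=> /next_heightE next /IHp->; rewrite big_ord_recl; congr (_ + _).
  by rewrite !rank_cons !rank0 /=; lia.
by apply: eq_bigr => k _; rewrite !lift0 !rank_cons; lia.
Qed.

Lemma rank_opposite_size p c : is_path 0 p -> rank (opposite c) p (size p) = rank c p (size p).
Proof. by case/is_pathP=> _ _ end0; case: c => [[]|]. Qed.

(** * Matchings *)

Section Matching.
Variable N : nat.
Implicit Types (w : 'S_N) (x y z : 'I_N) (p : N.-tuple (option bool)).
Local Open Scope group_scope.

(* Ups and downs are matched first in, first out: the arcs of an involution avoiding 321
   cannot be nested. *)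
Definition matched p x y : bool :=
  (step p y == opposite (step p x)) && (rank (step p x) p x == rank (step p y) p y).

Lemma oppositeK : involutive (omap negb).
Proof. by case=> [[]|]. Qed.

Lemma matched_sym p x y : matched p x y = matched p y x.
Proof. by rewrite /matched eq_sym (can2_eq oppositeK oppositeK) [rank _ _ x == _]eq_sym. Qed.

Lemma matched_fun p x y z : matched p x y -> matched p x z -> y = z.
Proof.
case/andP=> /eqP py /eqP ry /andP[/eqP pz /eqP rz].
by apply/ord_inj/(@rank_inj p); [rewrite py pz | rewrite -ry -rz].
Qed.

Lemma matched_total p x : is_path 0 p -> exists y, matched p x y.
Proof.
move=> /(rank_opposite_size (step p x)); rewrite size_tuple => balanced.
have := rank_lt p (ltn_ord x); rewrite -balanced => /rank_onto[j [lt_j pj rj]].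
by exists (Ordinal lt_j); rewrite /matched /= pj rj !eqxx.
Qed.

Definition matching p w : Prop := forall x, matched p x (w x).

Lemma matching_involutive p w : matching p w -> involutive w.
Proof. by move=> wP x; apply: matched_fun (wP (w x)) _; rewrite matched_sym. Qed.

Lemma matching_uniq p w w' : matching p w -> matching p w' -> w = w'.
Proof. by move=> wP wP'; apply/permP=> x; apply: matched_fun (wP x) (wP' x). Qed.

Lemma matching_exists p : is_path 0 p -> exists w, matching p w.
Proof.
move=> p_path; have /fin_all_exists[f fP] x := matched_total x p_path.
have fK : involutive f by move=> x; apply: matched_fun (fP (f x)) _; rewrite matched_sym.
by exists (perm (inv_inj fK)) => x; rewrite permE.
Qed.

Definition step_type w x : option bool :=
  if x < w x then up else if w x < x then down else flat.

Definition perm_path w : N.-tuple (option bool) := [tuple step_type w x | x < N].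

Lemma nth_perm_path w x : step (perm_path w) x = step_type w x.
Proof. by rewrite -tnth_nth tnth_mktuple. Qed.

Section PathMatching.
Variables (p : N.-tuple (option bool)) (w : 'S_N).
Hypotheses (p_path : is_path 0 p) (wP : matching p w).

Lemma matching_opposite x : step p (w x) = opposite (step p x).
Proof. by have /andP[/eqP] := wP x. Qed.

Lemma matching_rank x : rank (step p x) p x = rank (opposite (step p x)) p (w x).
Proof. by rewrite -matching_opposite; have /andP[_ /eqP] := wP x. Qed.

Lemma matching_increasing x y : step p x = step p y -> x < y -> w x < w y.
Proof.
move=> pxy /(rank_lt p); rewrite matching_rank pxy matching_rank.
by apply: contraLR; rewrite -!leqNgt; apply: rank_mono.
Qed.

Lemma matching_flat x : step p x = flat -> w x = x.
Proof.
move=> px; apply/ord_inj/(@rank_inj p); first by rewrite matching_opposite px.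
by rewrite [RHS]matching_rank matching_opposite.
Qed.

Lemma matching_up x : step p x = up -> x < w x.
Proof.
move=> px; have pwx : step p (w x) = down by rewrite matching_opposite px.
have rx := matching_rank x; rewrite px /= in rx.
case: (ltngtP x (w x)) => // [gt_x|/ord_inj ex]; last by rewrite -ex px in pwx.
have [_ /(_ (w x).+1) above0 _] := is_pathP 0 p p_path.
have := above0 _; rewrite size_tuple ltn_ord rankS pwx eqxx => /(_ isT).
by have := rank_mono up p gt_x; lia.
Qed.

Lemma matching_down x : step p x = down -> w x < x.
Proof.
move=> px; rewrite -{2}[x](matching_involutive wP); apply: matching_up.
by rewrite matching_opposite px.
Qed.

Lemma matching_flat_left x y : step p y = flat -> x < y -> w x < y.
Proof.
move=> py lt_xy; case px: (step p x) => [[]|]; last by rewrite matching_flat.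
  have := rank_lt p lt_xy; rewrite matching_rank px /=.
  have [at0 _ _] := is_pathP 0 p p_path; have := at0 y; rewrite size_tuple => /(_ (ltn_ord y) py).
  by have := rank_mono down p (_ : y <= w x); lia.
exact: ltn_trans (matching_down px) lt_xy.
Qed.

Lemma matching_flat_right x y : step p x = flat -> x < y -> x < w y.
Proof.
move=> px lt_xy; case: (ltngtP x (w y)) => // [/(matching_flat_left px)|/ord_inj ex].
  by rewrite (matching_involutive wP) ltnNge ltnW.
by move: lt_xy; rewrite -(matching_involutive wP y) -ex matching_flat ?ltnn.
Qed.

Lemma matching_inversion x y : x < y -> w y < w x -> step p x = up /\ step p y = down.
Proof.
move=> lt_xy lt_w; have [pxy|ne_p] := eqVneq (step p x) (step p y).
  by have := matching_increasing pxy lt_xy; rewrite ltnNge ltnW.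
have [px|nx] := eqVneq (step p x) flat.
  by have := matching_flat_right px lt_xy; rewrite -{1}(matching_flat px) ltnNge ltnW.
have [py|ny] := eqVneq (step p y) flat.
  by have := matching_flat_left py lt_xy; rewrite -{1}(matching_flat py) ltnNge ltnW.
case px: (step p x) => [[]|]; case py: (step p y) => [[]|]; rewrite px py // in nx ny ne_p *.
by have := matching_down px; have := matching_up py; lia.
Qed.

Lemma matching_avoids321 : avoids321 w.
Proof.
apply: avoids321_of_inversion => x y lt_xy /(matching_inversion lt_xy)[px py].
by split; [apply: matching_up | apply: matching_down].
Qed.

Lemma matching_perm_path : perm_path w = p.
Proof.
apply: eq_from_tnth => x; rewrite !(tnth_nth flat) nth_perm_path /step_type.
case px: (step p x) => [[]|]; first by rewrite matching_up.
  by rewrite ltnNge ltnW ?matching_down.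
by rewrite matching_flat // ltnn.
Qed.

End PathMatching.

Lemma step_type_up w x : (step_type w x == up) = (x < w x).
Proof. by rewrite /step_type; case: ltngtP. Qed.

Lemma step_type_down w x : (step_type w x == down) = (w x < x).
Proof. by rewrite /step_type; case: ltngtP. Qed.

Lemma step_type_flat w x : step_type w x = flat -> w x = x.
Proof. by rewrite /step_type; case: ltngtP => // /ord_inj. Qed.

Lemma step_type_image w x :
  involutive w -> step_type w (w x) = opposite (step_type w x).
Proof. by move=> wK; rewrite /step_type wK; case: ltngtP. Qed.

Lemma step_type_ltn w x y :
  avoids321 w -> step_type w x = step_type w y -> (w x < w y) = (x < y).
Proof.
move=> av; wlog lt_xy : x y / x < y => [IH exy|exy].
  have [lt_xy|lt_yx|/ord_inj->] := ltngtP x y; last by rewrite ltnn.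
    by rewrite (IH x y) // ltnW.
  have := IH y x lt_yx (esym exy); lia.
rewrite lt_xy; have := perm_neq w lt_xy.
case: ltngtP => // lt_w _; have [lt_x lt_y] := avoids321_inversion av lt_xy lt_w.
by move: exy lt_x lt_y; rewrite -step_type_up -step_type_down => -> /eqP->.
Qed.

Lemma rank_perm_path w c k :
  k <= N -> rank c (perm_path w) k = #|[set x : 'I_N | (x < k) && (step_type w x == c)]|.
Proof.
move=> le_k; rewrite (rank_card _ _ le_k).
by apply: eq_card => x; rewrite !inE nth_perm_path.
Qed.

Lemma perm_path_matching w : avoids321 w -> involutive w -> matching (perm_path w) w.
Proof.
move=> av wK x; have wxE := step_type_image x wK.
have le_N (y : 'I_N) : y <= N := ltnW (ltn_ord y).
rewrite /matched !nth_perm_path wxE eqxx /= !rank_perm_path //.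
rewrite -[X in _ == X](card_preimset _ (@perm_inj _ w)); apply/eqP/eq_card => y.
rewrite !inE step_type_image // (inj_eq (inv_inj oppositeK)).
by case: eqP => [/(step_type_ltn av)->|]; rewrite ?andbF.
Qed.

Lemma rank_up_perm_path w k : involutive w -> k <= N ->
  rank up (perm_path w) k = rank down (perm_path w) k + crossings w k.
Proof.
move=> wK le_k; rewrite !rank_perm_path // addnC.
rewrite -(cardsID [set x : 'I_N | k <= w x] [set x | _ & step_type w x == up]).
congr (_ + _); first by apply: eq_card => x; rewrite !inE step_type_up; lia.
rewrite -[RHS](card_preimset _ (@perm_inj _ w)).
by apply: eq_card => x; rewrite !inE step_type_up step_type_down wK; lia.
Qed.

Lemma avoids321_crossings_fixed w x : avoids321 w -> w x = x -> crossings w x = 0.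
Proof.
move=> av wx; apply: eq_card0 => y; rewrite !inE; apply/negP=> /andP[lt_yx le_x].
have lt_w : w x < w y by rewrite wx; have := perm_neq w lt_yx; rewrite wx; lia.
by have [_] := avoids321_inversion av lt_yx lt_w; rewrite wx ltnn.
Qed.

Lemma perm_path_is_path w : avoids321 w -> involutive w -> is_path 0 (perm_path w).
Proof.
move=> av wK; apply/is_pathP; rewrite size_tuple; split=> [k lt_k|k le_k|].
- rewrite (nth_perm_path w (Ordinal lt_k)) add0n rank_up_perm_path // 1?ltnW //.
  by move=> /step_type_flat/(avoids321_crossings_fixed av) /= ->; rewrite addn0.
- by rewrite add0n rank_up_perm_path // leq_addr.
- by rewrite add0n rank_up_perm_path // crossings_size addn0.
Qed.

Lemma area_perm_path w : avoids321 w -> involutive w ->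
  area 0 (perm_path w) = \sum_(k < N) crossings w k.+1.
Proof.
move=> av wK; rewrite area_rank ?perm_path_is_path // size_tuple.
by apply: eq_bigr => k _; rewrite add0n rank_up_perm_path // addKn.
Qed.

End Matching.

Section FullyCommutativeInvolutions.
Variable n : nat.
Implicit Types w : 'S_n.+1.
Local Open Scope group_scope.

Lemma fc_involutionP w : reflect (avoids321 w /\ involutive w) (fc_involution w).
Proof.
rewrite /fc_involution fully_commutativeE; apply: (iffP andP) => -[av w2]; split=> //.
  by move/eqP: w2; rewrite expgS expg1 => w2 x; rewrite -permM w2 perm1.
by apply/eqP/permP=> x; rewrite expgS expg1 permM perm1 w2.
Qed.

Lemma area_fc_involution w : fc_involution w -> area 0 (perm_path w) = coxeter_length w.
Proof.
case/fc_involutionP=> av wK; rewrite area_perm_path // avoids321_length //.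
by rewrite big_ord_recr /= crossings_size addn0.
Qed.

Lemma perm_path_inj : {in @fc_involution n &, injective (@perm_path n.+1)}.
Proof.
move=> w w' /fc_involutionP[av wK] /fc_involutionP[av' wK'] eq_path.
apply: (matching_uniq (perm_path_matching av wK)).
by rewrite eq_path; apply: perm_path_matching.
Qed.

Lemma perm_path_image :
  [set perm_path w | w in @fc_involution n] =i [pred p : n.+1.-tuple (option bool) | is_path 0 p].
Proof.
move=> p; rewrite inE; apply/imsetP/idP => [[w /fc_involutionP[av wK] ->]|p_path].
  exact: perm_path_is_path.
have [w wP] := matching_exists p_path; exists w; last by rewrite (matching_perm_path p_path wP).
apply/fc_involutionP; split; first exact: matching_avoids321 p_path wP.
exact: matching_involutive wP.
Qed.

End FullyCommutativeInvolutions.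

(** * Generating functions *)

Local Open Scope ring_scope.

Lemma big_tuple_cons (R : Type) (idx : R) (op : Monoid.com_law idx) (T : finType) L
    (P : pred (L.+1.-tuple T)) (F : L.+1.-tuple T -> R) :
  \big[op/idx]_(t | P t) F t =
  \big[op/idx]_(c : T) \big[op/idx]_(t : L.-tuple T | P [tuple of c :: t]) F [tuple of c :: t].
Proof.
rewrite pair_big_dep (reindex (fun ct : T * L.-tuple T => [tuple of ct.1 :: ct.2])) //=.
exists (fun t => (thead t, [tuple of behead t])) => [[c t]|t] _ /=; last by rewrite -tuple_eta.
by rewrite theadE; congr (_, _); apply: val_inj.
Qed.

Definition path_poly (L h : nat) : {poly int} :=
  \sum_(p : L.-tuple (option bool) | is_path h p) 'X^(area h p).

Lemma fc_inv_polyE n : fc_inv_poly n = path_poly n.+1 0.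
Proof.
rewrite /path_poly -(eq_bigl _ _ (@perm_path_image n)) big_imset /=; last exact: perm_path_inj.
by apply: eq_bigr => w /area_fc_involution->.
Qed.

Lemma path_poly0 h : path_poly 0 h = (h == 0%N)%:R.
Proof.
rewrite /path_poly; case: h => [|h]; last by rewrite big_pred0 // => p; rewrite tuple0.
by rewrite (big_pred1 [tuple]) // => p; rewrite tuple0.
Qed.

Lemma path_polyS L h :
  path_poly L.+1 h = \sum_(c | legal_step h c) 'X^(next_height h c) * path_poly L (next_height h c).
Proof.
rewrite /path_poly big_tuple_cons [RHS]big_mkcond; apply: eq_bigr => c _ /=.
case: legal_step => /=; last by rewrite big_pred0.
by rewrite mulr_sumr; apply: eq_bigr => p _; rewrite exprD.
Qed.

Lemma path_polyS0 L : path_poly L.+1 0 = 'X * path_poly L 1 + path_poly L 0.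
Proof.
rewrite path_polyS (bigD1 up) //= (big_pred1 flat) /= ?mul1r //.
by case=> [[]|].
Qed.

Lemma path_polySS L h :
  path_poly L.+1 h.+1 = 'X^(h.+2) * path_poly L h.+2 + 'X^h * path_poly L h.
Proof. by rewrite path_polyS (bigD1 up) //= (big_pred1 down) //; case=> [[]|]. Qed.

Lemma eq_fps_div (K : fieldType) (f f' d d' : nat -> K) :
  f =1 f' -> d =1 d' -> fps_div f d =1 fps_div f' d'.
Proof.
move=> ef ed n; elim/ltn_ind: n => n IHn; rewrite !fps_divE ef ed; congr ((_ - _) / _).
by apply: eq_bigr => i _; rewrite IHn // ed.
Qed.

Lemma fps_div_unique (K : fieldType) (f g d : nat -> K) :
  d 0%N != 0 -> fps_mul f d =1 g -> f =1 fps_div g d.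
Proof. by move=> d0 fdg n; rewrite -(eq_fps_div fdg (frefl d)) fps_mulK. Qed.

Lemma q_pochhammerS (K : fieldType) (a p : K) m :
  q_pochhammer a p m.+1 = q_pochhammer a p m * (1 - a * p ^+ m).
Proof. exact: big_ord_recr. Qed.

Section QBinomial.
Variables (K : fieldType) (p : K).
Hypothesis p_not_root : forall i, p ^+ i.+1 != 1.

Lemma q_pochhammer_neq0 m : q_pochhammer p p m != 0.
Proof.
elim: m => [|m IHm]; first by rewrite /q_pochhammer big_ord0 oner_eq0.
by rewrite q_pochhammerS mulf_neq0 // subr_eq0 eq_sym -exprS.
Qed.

Lemma q_binomial0 m : q_binomial p m 0 = 1.
Proof.
by rewrite /q_binomial subn0 {2}/q_pochhammer big_ord0 mul1r divff ?q_pochhammer_neq0.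
Qed.

Lemma q_pascal m i : (i < m)%N ->
  q_binomial p m.+1 i.+1 = q_binomial p m i.+1 + p ^+ (m - i) * q_binomial p m i.
Proof.
move=> /subnKC <-; move: (m - i.+1)%N => k; rewrite /q_binomial subSS addKn.
rewrite (_ : i.+1 + k - i = k.+1)%N; last lia.
have := q_pochhammer_neq0 i.+1; have := q_pochhammer_neq0 k.+1.
rewrite (q_pochhammerS p p (_ + _)) (q_pochhammerS p p i) (q_pochhammerS p p k).
rewrite -!exprS -addnS exprD.
rewrite !mulf_eq0 !negb_or => /andP[k_neq0 k1_neq0] /andP[i_neq0 i1_neq0].
by field; rewrite ?i_neq0 ?i1_neq0 ?k_neq0 ?k1_neq0.
Qed.

End QBinomial.

Section BilateralPaths.
Variables (K : fieldType) (q : K).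
Hypothesis q_neq0 : q != 0.
Hypothesis q_not_root : forall i, q ^+ i.+1 != 1.
Local Notation p := (q ^+ 2).

Lemma sqr_not_root i : p ^+ i.+1 != 1.
Proof. by rewrite -exprM mulnS; apply: q_not_root. Qed.

(* The sum of [q ^ (sum of the heights after each step)] over the paths of length [L] with
   steps +1 and -1 from height [h] to height 0, which may go below 0; [u] is the number
   of steps +1. *)
Definition bilateral (h L : nat) : K :=
  let u := (L - h)./2 in
  if (h <= L)%N && ~~ odd (L - h)
  then q_binomial p L u * q ^ ('C(h, 2)%:Z - (u ^ 2)%N%:Z) else 0.

Lemma bilateralE h u :
  bilateral h (h + u.*2) = q_binomial p (h + u.*2) u * q ^ ('C(h, 2)%:Z - (u ^ 2)%N%:Z).
Proof. by rewrite /bilateral leq_addr addKn odd_double doubleK. Qed.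

Lemma bilateral_odd h u : bilateral h (h + u.*2).+1 = 0.
Proof. by rewrite /bilateral -addnS addKn /= odd_double andbF. Qed.

Lemma bilateral_short h L : (L < h)%N -> bilateral h L = 0.
Proof. by rewrite /bilateral ltnNge => /negbTE->. Qed.

Lemma bilateralS_even h u : bilateral h.+1 (h + u.*2) = 0.
Proof.
case: u => [|u]; first by rewrite bilateral_short ?addn0.
by rewrite doubleS !addnS -addSn bilateral_odd.
Qed.

Lemma bilateral_diag h : bilateral h h = q ^+ 'C(h, 2).
Proof.
have := bilateralE h 0; rewrite addn0 q_binomial0 ?mul1r ?subr0 //; exact: sqr_not_root.
Qed.

Lemma bilateralSS h L :
  bilateral h.+1 L.+1 = q ^+ h.+2 * bilateral h.+2 L + q ^+ h * bilateral h L.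
Proof.
have [lt_L|] := ltnP L h; first by rewrite !bilateral_short ?mulr0 ?addr0 //; lia.
move=> /subnKC <-; rewrite -(odd_double_half (L - h)).
case: (odd _) => /=; move: (_./2) => u.
  rewrite add1n addnS -[in LHS]addSn -[in X in _ + X]addSn !bilateral_odd.
  by rewrite -addSn bilateralS_even !mulr0 addr0.
rewrite add0n; case: u => [|u].
  by rewrite !addn0 !bilateral_diag bilateral_short // mulr0 add0r -exprD binS bin1 addnC.
have q_next : q ^+ h * q ^ ('C(h, 2)%:Z - (u.+1 ^ 2)%N%:Z)
    = q ^ ('C(h.+1, 2)%:Z - (u.+1 ^ 2)%N%:Z).
  by rewrite [q ^+ h]exprnP -expfzDr // binS bin1; congr (_ ^ _); lia.
have q_prev : q ^+ h.+2 * q ^ ('C(h.+2, 2)%:Z - (u ^ 2)%N%:Z)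
    = p ^+ (h + u.+2) * q ^ ('C(h.+1, 2)%:Z - (u.+1 ^ 2)%N%:Z).
  rewrite -exprM [q ^+ h.+2]exprnP [q ^+ (2 * _)]exprnP -!expfzDr // !(binS _.+1) !bin1.
  by congr (_ ^ _); rewrite -!mulnn; lia.
have length_eq : (h + u.+1.*2 = h.+2 + u.*2)%N by rewrite doubleS; lia.
rewrite -addSn !bilateralE [in bilateral h.+2 _]length_eq bilateralE -length_eq addSn.
rewrite (q_pascal sqr_not_root); last by rewrite -addnn; lia.
rewrite (_ : h + u.+1.*2 - u = h + u.+2)%N; last by rewrite -addnn; lia.
by rewrite [q ^+ h.+2 * _]mulrCA q_prev [q ^+ h * _]mulrCA q_next; ring.
Qed.

(* The defect of [bilateral 0] in the recursion [F_ground] below. *)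
Definition denominator (n : nat) : K :=
  if n is m.+1 then bilateral 0 m.+1 - q * bilateral 1 m - bilateral 0 m else 1.

Section Recursion.
Variable F : nat -> nat -> K.
Hypothesis F_nil : forall h, F 0%N h = (h == 0%N)%:R.
Hypothesis F_ground : forall L, F L.+1 0%N = q * F L 1%N + F L 0%N.
Hypothesis F_above : forall L h, F L.+1 h.+1 = q ^+ h.+2 * F L h.+2 + q ^+ h * F L h.

Lemma mul_denominator n h : fps_mul (F ^~ h) denominator n = bilateral h n.
Proof.
rewrite /fps_mul; elim: n h => [|n IHn] h.
  rewrite big_ord1 F_nil mulr1; case: h => [|h]; last by rewrite bilateral_short.
  by rewrite bilateral_diag.
rewrite big_ord_recl F_nil subn0; case: h => [|h].
  under eq_bigr => i _ do rewrite lift0 F_ground subSS mulrDl -mulrA.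
  by rewrite big_split -mulr_sumr !IHn /= mul1r; ring.
under eq_bigr => i _ do rewrite lift0 F_above subSS mulrDl -(mulrA (q ^+ h.+2)) -(mulrA (q ^+ h)).
by rewrite big_split -!mulr_sumr !IHn /= mul0r add0r bilateralSS.
Qed.

Lemma fps_div_bilateral :
  (fun n => F n.+1 0%N) =1 fps_div (fun j => q * bilateral 1 j + bilateral 0 j) denominator.
Proof.
apply: fps_div_unique => [|n]; first exact: oner_neq0.
rewrite -!mul_denominator /fps_mul mulr_sumr -big_split.
by apply: eq_bigr => i _; rewrite F_ground /= mulrDl mulrA.
Qed.

End Recursion.

Lemma bilateral0_even u : bilateral 0 u.*2 = q_binomial p u.*2 u * q ^ (- (u ^ 2)%N%:Z).
Proof. by rewrite -[u.*2]add0n bilateralE sub0r. Qed.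

Lemma bilateral0_odd u : bilateral 0 u.*2.+1 = 0.
Proof. exact: (bilateral_odd 0 u). Qed.

Lemma bilateral1_even u : bilateral 1 u.*2 = 0.
Proof. exact: (bilateralS_even 0 u). Qed.

Lemma bilateral1_odd u :
  bilateral 1 u.*2.+1 = q_binomial p u.*2.+1 u * q ^ (- (u ^ 2)%N%:Z).
Proof. by rewrite -[u.*2.+1]add1n bilateralE sub0r. Qed.

Lemma numeratorE j :
  q * bilateral 1 j + bilateral 0 j =
  q_binomial p j j./2 * q ^ (- ((j./2 ^ 2)%N%:Z) + (odd j : nat)%:Z).
Proof.
rewrite -{1 2 3}(odd_double_half j); case: (odd j); move: (j./2) => u /=.
  rewrite add1n bilateral0_odd bilateral1_odd addr0 mulrCA.
  by rewrite -[X in _ * (X * _)](expr1z q) -expfzDr // addrC.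
by rewrite add0n bilateral0_even bilateral1_even mulr0 add0r addr0.
Qed.

Lemma denominatorE j :
  denominator j =
  if j == 0%N then 1
  else (- 1) ^+ j * (q_binomial p j.-1 j./2 * q ^ (- ((j./2 ^ 2)%N%:Z))).
Proof.
case: j => [|j] //=; rewrite -(odd_double_half j) -signr_odd.
case: (odd j) => /=; move: (j./2) => u; rewrite ?add1n ?add0n /= ?odd_double ?doubleK; last first.
  rewrite uphalf_double expr1 bilateral0_odd bilateral1_even bilateral0_even.
  by rewrite mulr0 subr0 sub0r mulN1r.
rewrite expr0 mul1r bilateral0_odd subr0 bilateral1_odd -doubleS bilateral0_even doubleS.
rewrite (q_pascal sqr_not_root); last lia.
have q_shift : q * q ^ (- (u ^ 2)%N%:Z) = p ^+ (u.*2.+1 - u) * q ^ (- (u.+1 ^ 2)%N%:Z).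
  rewrite -exprM -[X in X * _ = _](expr1z q) [q ^+ _]exprnP -!expfzDr //; congr (_ ^ _).
  by rewrite -!mulnn -addnn; lia.
by rewrite [q * _]mulrCA q_shift; ring.
Qed.

End BilateralPaths.

Lemma qvar_neq0 : qvar != 0.
Proof. by rewrite tofrac_eq0 polyX_eq0. Qed.

Lemma qvar_not_root i : qvar ^+ i.+1 != 1.
Proof.
rewrite -tofracXn -tofrac1 tofrac_eq; apply/eqP=> /(congr1 (fun r : {poly int} => size r)).
by rewrite size_polyXn size_poly1.
Qed.

Theorem theorem6p4 :
  (fun n : nat => tofrac (fc_inv_poly n)) =1
  fps_div
    (fun j : nat =>
       q_binomial (qvar ^+ 2) j j./2
         * qvar ^ (- ((j./2 ^ 2)%N%:Z) + (odd j : nat)%:Z))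
    (fun j : nat =>
       if j == 0%N then 1
       else (- 1) ^+ j * (q_binomial (qvar ^+ 2) j.-1 j./2
                            * qvar ^ (- ((j./2 ^ 2)%N%:Z)))).
Proof.
pose F L h : {fraction {poly int}} := tofrac (path_poly L h).
have F_nil h : F 0%N h = (h == 0%N)%:R by rewrite /F path_poly0 rmorph_nat.
have F_ground L : F L.+1 0%N = qvar * F L 1%N + F L 0%N by rewrite /F path_polyS0 rmorphD rmorphM.
have F_above L h : F L.+1 h.+1 = qvar ^+ h.+2 * F L h.+2 + qvar ^+ h * F L h.
  by rewrite /F /qvar -!tofracXn -!tofracM -tofracD path_polySS.
move=> n; rewrite fc_inv_polyE.
rewrite -[LHS]/(F n.+1 0%N) (fps_div_bilateral qvar_neq0 qvar_not_root F_nil F_ground F_above).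
apply: eq_fps_div => j; first exact: numeratorE qvar_neq0 _.
exact: denominatorE qvar_neq0 qvar_not_root _.
Qed.
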